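(* Let $X$ be a countable regular crowded space whose $\pi$-weight is a cardinal of uncountable cofinality. Then $X$ has far points.
   Context: All spaces are Tychonoff (in particular Hausdorff). A space is crowded if it is non-empty and has no isolated points. A $\pi$-base of $X$ is a family of non-empty open subsets of $X$ such that every non-empty open subset of $X$ contains a member of the family; the $\pi$-weight of $X$ is the minimal cardinality of a $\pi$-base of $X$. $\beta X$ is the Čech–Stone compactification of $X$. A far point of $X$ is a point $p\in\beta X\setminus X$ such that $p\notin\mathrm{cl}_{\beta X}(D)$ for every closed discrete subset $D$ of $X$. *)

(* Defs.v *)
From HB Require Import structures.
From mathcomp Require Import all_boot all_order all_algebra.
From mathcomp Require Import all_classical all_reals all_analysis.
From mathcomp Require wochoice.

Set Implicit Arguments.
Unset Strict Implicit.
Unset Printing Implicit Defensive.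

Import Order.TTheory GRing.Theory Num.Theory.
Import numFieldNormedType.Exports.

Local Open Scope classical_set_scope.
Local Open Scope card_scope.
Local Open Scope ring_scope.

Definition crowded (X : topologicalType) : Prop :=
  [set: X] !=set0 /\ isolated [set: X] = set0.

Definition closed_discrete (X : topologicalType) (D : set X) : Prop :=
  closed D /\ isolated D = D.

Definition pi_base (X : topologicalType) (B : set (set X)) : Prop :=
  (forall U, B U -> open U /\ U !=set0) /\
  (forall V : set X, open V -> V !=set0 -> exists2 U, B U & U `<=` V).

(* Cardinals are represented by types up to bijection. *)
Definition is_pi_weight (X : topologicalType) (K : Type) : Prop :=
  (exists2 B : set (set X), pi_base B & B #= [set: K]) /\
  (forall B : set (set X), pi_base B -> [set: K] #<= B).

(* [le] has as order type the least ordinal (von Neumann cardinal) of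
   cardinality [K]. *)
Definition initial_well_order (K : Type) (le : rel K) : Prop :=
  wochoice.well_order le /\
  (forall a : K, ~ ([set: K] #<= [set b : K | le b a /\ b <> a])).

Definition cofinal (K : Type) (le : rel K) (C : set K) : Prop :=
  forall a : K, exists2 c, C c & le a c.

(* The cofinality of the cardinal [K] is the least cardinality of a cofinal
   subset of the corresponding initial ordinal. An initial well-order of [K] is
   unique up to isomorphism, so it does not matter which one is used. *)
Definition uncountable_cofinality (K : Type) : Prop :=
  exists2 le : rel K, initial_well_order le &
    forall C : set K, cofinal le C -> ~ countable C.

(* beta X is the closure of the image of X under the evaluation map into the
   power of [0, 1] indexed by the continuous functions X -> [0, 1]; that power
   is a closed subset of the corresponding power of R, where the closure is
   taken. *)
Section StoneCech.
Context (R : realType) (X : topologicalType).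

Definition unit_fun : Type :=
  {f : X -> R | continuous f /\ forall x, 0 <= f x <= 1}.

Definition evaluation (x : X) : prod_topology (fun _ : unit_fun => R) :=
  fun f => sval f x.

Definition stone_cech : topologicalType :=
  set_type (closure (range evaluation)).

Definition to_stone_cech (x : X) : stone_cech :=
  SigSub (mem_set (subset_closure (imageT evaluation x))).

Definition far_point (p : stone_cech) : Prop :=
  ~ range to_stone_cech p /\
  forall D : set X, closed_discrete D -> ~ closure (to_stone_cech @` D) p.

End StoneCech.

(* Main.v *)
(** Index a pi-base of minimal size by K as B and, for a in K, let F_a be the
   family of the finite intersections of the B_b with b <= a. Since F_a has
   fewer members than the pi-weight and every map from X to K is bounded, the
   points at which some F_a contains a local pi-base are not dense, so some
   non-empty clopen set avoids them; split it into a discrete family of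
   non-empty clopen sets Z_n. At its points, for every a, a closed discrete set
   D has a clopen neighbourhood that contains no member of F_a inside Z_n.
   Iterating n times along a sequence of ranks a in K gives a clopen
   neighbourhood of D in Z_n such that no n of these cover Z_n (van Douwen's
   argument for remote points). The ranks stay bounded because, by the
   countability of X and the cofinality of K, every open set O has a dense open
   part that is the union of the members of one F_j contained in O. The unions
   over n of the complements in Z_n form a clopen filter base, and any of its
   cluster points in beta X is a far point. *)

Require Import Defs.
From mathcomp Require Import all_boot all_order all_algebra.
From mathcomp Require Import all_classical all_reals all_analysis.
From mathcomp Require wochoice.

Set Implicit Arguments.
Unset Strict Implicit.
Unset Printing Implicit Defensive.

Import Order.TTheory GRing.Theory Num.Theory.
Import numFieldNormedType.Exports.

Local Open Scope classical_set_scope.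
Local Open Scope card_scope.

(** * Finite sequences in an infinite type *)

Lemma rel_injfun (T : Type) (A B : set T) (G : T -> T -> Prop) :
  (forall x, A x -> exists2 y, B y & G x y) ->
  (forall x x' y, G x y -> G x' y -> x = x') ->
  exists2 f : T -> T, set_fun A B f & set_inj A f.
Proof.
move=> Gdom Ginj.
have /choice[f fG] x : exists y, A x -> B y /\ G x y.
  by have [/Gdom[y]|nA] := pselect (A x); [exists y | exists x].
exists f => [x /fG[]//|x x' /set_mem/fG[_ Gx] /set_mem/fG[_ Gx'] e].
by rewrite e in Gx; exact: Ginj Gx Gx'.
Qed.

(** Zorn's lemma applies to graphs of partial injections from A to B. A maximal graph that missed
    both some x of A and some y of B could be enlarged by (x, y). *)
Lemma comparable_sets (T : Type) (A B : set T) :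
  (exists2 f : T -> T, set_fun A B f & set_inj A f) \/
  (exists2 f : T -> T, set_fun B A f & set_inj B f).
Proof.
pose P (G : set (T * T)) := [/\ G `<=` A `*` B,
  forall x y y', G (x, y) -> G (x, y') -> y = y' &
  forall x x' y, G (x, y) -> G (x', y) -> x = x'].
have [F FP Ftot|G [[GAB Gfun Ginj] Gmax]] := @Zorn_bigcup _ P.
  have common p q X Y : F X -> F Y -> X p -> Y q -> exists2 Z, F Z & Z p /\ Z q.
    by move=> FX FY Xp Yq; have [XY|YX] := Ftot _ _ FX FY;
      [exists Y => //; split => //; exact: XY | exists X => //; split => //; exact: YX].
  split=> [p [X FX Xp]|x y y' [X FX Xp] [Y FY Yq]|x x' y [X FX Xp] [Y FY Yq]].
  - by have [+ _ _] := FP _ FX; exact.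
  - have [Z FZ [Zp Zq]] := common _ _ _ _ FX FY Xp Yq.
    by have [_ + _] := FP _ FZ; apply; eassumption.
  - have [Z FZ [Zp Zq]] := common _ _ _ _ FX FY Xp Yq.
    by have [_ _] := FP _ FZ; apply; eassumption.
have [domG|] := pselect (forall x, A x -> exists2 y, B y & G (x, y)).
  by left; exact: rel_injfun domG Ginj.
have [ranG|] := pselect (forall y, B y -> exists2 x, A x & G (x, y)).
  by right; apply: rel_injfun ranG _ => y y' x; exact: Gfun.
move=> /existsNP[y /not_implyP[By yG]] /existsNP[x /not_implyP[Ax xG]].
have {}yG x' : ~ G (x', y) by move=> G'; apply: yG; exists x' => //; have [] := GAB _ G'.
have {}xG y' : ~ G (x, y') by move=> G'; apply: xG; exists y' => //; have [] := GAB _ G'.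
exfalso; apply: (Gmax (G `|` [set (x, y)])).
  split=> [p|/(_ (x, y) (or_intror erefl))]; [by left | exact: yG].
split=> [p [/GAB//|->//]|a b b' [Gb|[ea eb]] [Gb'|[ea' eb']]|
         a a' b [Gb|[ea eb]] [Gb'|[ea' eb']]]; subst => //.
- exact: Gfun Gb Gb'.
- by case: (xG _ Gb).
- by case: (xG _ Gb').
- exact: Ginj Gb Gb'.
- by case: (yG _ Gb).
- by case: (yG _ Gb').
Qed.

Definition seqs (T : eqType) (A : set T) : set (seq T) :=
  [set s | forall x, x \in s -> A x].

Definition seq_coding (T : eqType) (A : set T) (f : seq T -> T) :=
  set_fun (seqs A) A f /\ set_inj (seqs A) f.

(** Each letter of C becomes a word over A whose length, one or two, tells whether the letter lies
    in A. [f] turns this word into one letter of A, and applied once more it codes the whole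
    word. *)
Lemma seq_coding_extend (T : eqType) (A C : set T) f k :
  seq_coding A f -> set_fun (C `\` A) A k -> set_inj (C `\` A) k ->
  exists2 g : seq T -> T, set_fun (seqs C) A g & set_inj (seqs C) g.
Proof.
move=> [fA finj] kA kinj.
pose c x := if pselect (A x) then f [:: x] else f [:: k x; k x].
have A1 x : A x -> seqs A [:: x] by move=> Ax y; rewrite inE => /eqP ->.
have A2 x : A x -> seqs A [:: x; x] by move=> Ax y; rewrite !inE orbb => /eqP ->.
have cA x : C x -> A (c x).
  by rewrite /c; case: pselect => Ax Cx; apply: fA; [exact: A1|apply/A2/kA].
have cinj x y : C x -> C y -> c x = c y -> x = y.
  rewrite /c; case: pselect => Ax; case: pselect => Ay Cx Cy /finj.
  - by move=> /(_ (mem_set (A1 _ Ax)) (mem_set (A1 _ Ay)))[].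
  - by move=> /(_ (mem_set (A1 _ Ax)) (mem_set (A2 _ (kA _ (conj Cy Ay))))).
  - by move=> /(_ (mem_set (A2 _ (kA _ (conj Cx Ax)))) (mem_set (A1 _ Ay))).
  - move=> /(_ (mem_set (A2 _ (kA _ (conj Cx Ax)))) (mem_set (A2 _ (kA _ (conj Cy Ay)))))[+ _].
    by apply: kinj; apply: mem_set.
have cs s : seqs C s -> seqs A (map c s).
  by move=> Cs _ /mapP[x /Cs Cx ->]; exact: cA.
exists (f \o map c) => [s /cs/fA//|s t /set_mem Cs /set_mem Ct /= e].
have {e} : map c s = map c t by apply: finj e; apply/mem_set/cs.
elim: s t Cs Ct => [|x s IH] [|y t]//= Cs Ct [/cinj xy /IH st].
have hd z u : seqs C (z :: u) -> C z by apply; rewrite inE eqxx.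
have tl z u : seqs C (z :: u) -> seqs C u by move=> Czu w wu; apply: Czu; rewrite inE wu orbT.
by congr cons; [exact: xy (hd _ _ Cs) (hd _ _ Ct) | exact: st (tl _ _ Cs) (tl _ _ Ct)].
Qed.

(* Zorn's lemma gives a maximal A with an injection seq A -> A. If A did not
   dominate its complement, the complement would contain a copy of A, which could
   be added to A. *)
Lemma seq_inj_infinite (T : Type) : infinite_set [set: T] ->
  exists f : seq T -> T, injective f.
Proof.
elim/Ppointed: T => [T|T]; first by rewrite emptyE => /(_ (finite_set0 _)).
move=> /infiniteP/pcard_injP[e /in2TT e_inj].
pose S := {p : set T * (seq T -> T) | seq_coding p.1 p.2}.
pose R (p q : S) := `[< (sval p).1 `<=` (sval q).1 /\
  forall s, seqs (sval p).1 s -> (sval p).2 s = (sval q).2 s >].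
have /choice[inv invE] x : exists n, range e x -> e n = x.
  by have [[n _ <-]|] := pselect (range e x); [exists n|exists 0].
(* A countable set to start from: a word over [range e] is a word of numbers, and [pickle] codes it
   by a number. *)
have t0P : seq_coding (range e) (e \o pickle \o map inv).
  split=> [s _|s t /set_mem es /set_mem et /e_inj/(pcan_inj pickleK) st].
    by exists (pickle (map inv s)).
  have : map e (map inv s) = map e (map inv t) by rewrite st.
  by rewrite -!map_comp !map_id_in// => x xs; apply: invE; [apply: et|apply: es].
have [| | |t tmax] := @ZL_preorder S (exist _ (_, _) t0P) R.
- by move=> p; apply/asboolP; split.
- move=> p q r /asboolP[pq epq] /asboolP[qr eqr]; apply/asboolP; split.
    exact: subset_trans pq qr.
  by move=> s ps; rewrite epq// eqr// => x /ps /pq.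
- move=> F Ftot.
  have [[p0 Fp0]|F0] := pselect (exists p, F p); last first.
    by exists (exist _ (_, _) t0P) => p Fp; case: F0; exists p.
  pose A := \bigcup_(p in F) (sval p).1.
  (* A finite word over the union of a chain is already a word over one member. *)
  have below s : seqs A s -> exists2 p, F p & seqs (sval p).1 s.
    elim: s => [_|x s IH xsA]; first by exists p0.
    have [p Fp ps] : exists2 p, F p & seqs (sval p).1 s.
      by apply: IH => y ys; apply: xsA; rewrite inE ys orbT.
    have [q Fq qx] : A x by apply: xsA; rewrite inE eqxx.
    have [/asboolP[pq _]|/asboolP[qp _]] := Ftot _ _ Fp Fq.
      by exists q => // y; rewrite inE => /orP[/eqP->//|/ps/pq].
    by exists p => // y; rewrite inE => /orP[/eqP->|/ps//]; exact: qp.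
  have agree s p q : F p -> F q -> seqs (sval p).1 s -> seqs (sval q).1 s ->
      (sval p).2 s = (sval q).2 s.
    move=> Fp Fq ps qs; have [/asboolP[_ ->//]|/asboolP[_ ->//]] := Ftot _ _ Fp Fq.
  have /choice[f fE] s : exists y, forall p, F p -> seqs (sval p).1 s -> y = (sval p).2 s.
    have [/below[p Fp ps]|nA] := pselect (seqs A s).
      by exists ((sval p).2 s) => q Fq qs; exact: agree.
    by exists point => p Fp ps; case: nA => x /ps px; exists p.
  have fP : seq_coding A f.
    split=> [s /below[p Fp ps]|s t /set_mem/below[p Fp ps] /set_mem/below[q Fq qt]].
      by rewrite (fE _ _ Fp ps); exists p => //; have [+ _] := svalP p; exact.
    have [r Fr [rs rt]] : exists2 r, F r & seqs (sval r).1 s /\ seqs (sval r).1 t.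
      have [/asboolP[pq _]|/asboolP[qp _]] := Ftot _ _ Fp Fq.
        by exists q => //; split=> // x /ps/pq.
      by exists p => //; split=> // x /qt/qp.
    rewrite (fE _ _ Fr rs) (fE _ _ Fr rt).
    by have [_] := svalP r; apply; apply/mem_set.
  exists (exist _ (A, f) fP) => p Fp; apply/asboolP; split=> [x px|s ps] /=.
    by exists p.
  by rewrite (fE _ _ Fp ps).
case: t => -[A f] /= fP in tmax.
have [[k kA kinj]|[k kA kinj]] := comparable_sets (~` A) A.
  have [||g _ ginj] := @seq_coding_extend T A setT f k fP; rewrite ?setTD//.
  by exists g => s t; apply: ginj; apply/mem_set.
have Ax0 : A (f [::]) by apply: fP.1.
have /choice[l l_def] y : exists x, forall x', A x' -> k x' = y -> x' = x.
  have [[x Ax <-]|nA] := pselect ((k @` A) y).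
    by exists x => x' Ax' /kinj; apply; apply/mem_set.
  by exists point => x Ax kx; case: nA; exists x.
have lE x : A x -> l (k x) = x by move=> Ax; rewrite -(l_def (k x) x).
pose C := A `|` k @` A.
have [||g gA ginj] := @seq_coding_extend T A C f l fP.
- by move=> _ [[//|[x Ax <-]] _]; rewrite lE.
- move=> x y /set_mem[[//|[{}x Ax <-]] _] /set_mem[[//|[{}y Ay <-]] _].
  by rewrite !lE// => ->.
(* Words over A keep their code in A. The other words over C get theirs in the copy of A under [k],
   which is disjoint from A, so the coding of A is properly extended. *)
have hP : seq_coding C (fun s => if pselect (seqs A s) then f s else k (g s)).
  split=> [s Cs /=|s t /set_mem Cs /set_mem Ct /=].
    case: pselect => [As|nAs]; first by left; apply: fP.1.
    by right; exists (g s) => //; exact: gA.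
  case: pselect => As; case: pselect => At /=.
  - by apply: fP.2; apply/mem_set.
  - by move=> e'; case: (kA _ (gA _ Ct)); rewrite -e'; exact: fP.1.
  - by move=> e'; case: (kA _ (gA _ Cs)); rewrite e'; exact: fP.1.
  - move=> /(kinj _ _ (mem_set (gA _ Cs)) (mem_set (gA _ Ct))).
    by apply: ginj; apply/mem_set.
have /asboolP[/= CA _] : R (exist _ (C, _) hP) (exist _ (A, f) fP).
  apply: tmax; apply/asboolP; split=> [x Ax|s As] /=; first by left.
  by case: pselect.
by case: (kA _ Ax0); apply: CA; right; exists (f [::]).
Qed.

Lemma range_seq_card_le (T U : Type) (S : set T) (g : seq S -> U) :
  infinite_set S -> range g #<= S.
Proof.
have := card_setT S; rewrite card_eq_le => /andP[TS ST] Sinf.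
have [f f_inj] : exists f : seq S -> S, injective f.
  by apply: seq_inj_infinite; apply: contra_not Sinf; exact: card_le_finite.
apply: card_le_trans (card_image_le _ _) _; apply: card_le_trans TS.
have /injfunPex[h] : exists2 h : seq S -> S, set_fun setT setT h & set_inj setT h.
  by exists f => // x y _ _ /f_inj.
exact: inj_card_le.
Qed.

(** * Order laws of a well-order, read off the minima of pairs and triples *)

Section WellOrder.
Context (K : Type) (le : rel K).
Hypothesis le_wo : wochoice.well_order le.

Lemma wo_min (A : set K) : A !=set0 -> exists2 z, A z & forall x, A x -> le z x.
Proof.
move=> [x Ax]; have [z [[]]] : exists! z, wochoice.minimum_of le [pred y | `[< A y >]] z.
  by apply: le_wo; exists x; rewrite inE.
rewrite inE => Az zmin _; exists z => // y Ay; apply: zmin.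
by rewrite inE.
Qed.

Lemma wo_total x y : le x y \/ le y x.
Proof.
have [z [->|->] zmin] := @wo_min [set z | z = x \/ z = y] (ex_intro _ x (or_introl erefl)).
- by left; apply: zmin; right.
- by right; apply: zmin; left.
Qed.

Lemma wo_refl x : le x x.
Proof. by case: (wo_total x x). Qed.

Lemma wo_anti x y : le x y -> le y x -> x = y.
Proof.
move=> xy yx.
have [z [_ zuniq]] : exists! z,
    wochoice.minimum_of le [pred z | `[< z = x \/ z = y >]] z.
  by apply: le_wo; exists x; rewrite inE; left.
have zE t : t = x \/ t = y -> t = z.
  move=> txy; apply/esym/zuniq; split; first by rewrite inE.
  move=> u; rewrite inE.
  by case: txy => ->; case=> -> //; exact: wo_refl.
exact: etrans (zE x (or_introl erefl)) (esym (zE y (or_intror erefl))).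
Qed.

Lemma wo_trans x y z : le x y -> le y z -> le x z.
Proof.
have [m] := @wo_min [set t | t = x \/ t = y \/ t = z] (ex_intro _ x (or_introl erefl)).
move=> mE mmin xy yz.
case: mE mmin => [|[]] ->  mmin.
- by apply: mmin; right; right.
- have yx := mmin x (or_introl erefl).
  by rewrite (wo_anti xy yx).
- have zy := mmin y (or_intror (or_introl erefl)).
  by rewrite (wo_anti zy yz).
Qed.

End WellOrder.

(** * Families of finite intersections *)

Inductive finmeet (X K : Type) (B : K -> set X) (S : set K) : set X -> Prop :=
| finmeetT : finmeet B S setT
| finmeetI k U : S k -> finmeet B S U -> finmeet B S (B k `&` U).

(** Finite intersections may be empty, so non-emptiness is asked for here. If every open
    neighbourhood O of a point is large, the family contains a local pi-base at that point. *)
Definition large (X K : Type) (B : K -> set X) (S : set K) (O : set X) :=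
  exists U, [/\ finmeet B S U, U !=set0 & U `<=` O].

Section Meets.
Context (X K : Type) (B : K -> set X).

Lemma finmeet_setI S U V : finmeet B S U -> finmeet B S V -> finmeet B S (U `&` V).
Proof.
move=> SU SV; elim: SU => [|k {}U Sk _ IH]; first by rewrite setTI.
by rewrite -setIA; exact: finmeetI.
Qed.

Lemma finmeet_sub S S' U : S `<=` S' -> finmeet B S U -> finmeet B S' U.
Proof.
by move=> SS'; elim=> [|k {}U /SS' Sk _ IH]; [exact: finmeetT | exact: finmeetI].
Qed.

Lemma finmeet1 S k : S k -> finmeet B S (B k).
Proof. by move=> Sk; rewrite -[B k]setIT; apply: finmeetI => //; exact: finmeetT. Qed.

Lemma large_sub S S' U V : S `<=` S' -> U `<=` V -> large B S U -> large B S' V.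
Proof.
move=> SS' UV [W [SW W0 WU]]; exists W; split=> //; first exact: finmeet_sub SW.
exact: subset_trans WU UV.
Qed.

Lemma finmeet_range S :
  finmeet B S `<=` range (fun s : seq S => foldr (fun k U => B (val k) `&` U) setT s).
Proof.
move=> U; elim=> [|k {}U Sk _ [s _ <-]]; first by exists [::].
by exists (SigSub (mem_set Sk) :: s).
Qed.

End Meets.

Lemma finmeet_open (X : topologicalType) (K : Type) (B : K -> set X) S U :
  (forall k, open (B k)) -> finmeet B S U -> open U.
Proof.
by move=> Bo; elim=> [|k {}U _ _ Uo]; [exact: openT | exact: openI].
Qed.

(** A pi-base has at least as many members as K, whereas a proper initial segment has fewer elements
    than K, and finite sequences in it do not make up for that. *)
Lemma finmeet_not_pi_base (X : topologicalType) (K : Type) (B : K -> set X) (le : rel K) a :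
  is_pi_weight X K -> initial_well_order le -> ~ countable [set: K] ->
  ~ pi_base [set U | finmeet B [set b | le b a /\ b <> a] U /\ U !=set0].
Proof.
move=> [_ Kmin] [_ le_init] Kunc /Kmin KS; pose S := [set b | le b a /\ b <> a].
have {}KS : [set: K] #<= range (fun s : seq S => foldr (fun k U => B (val k) `&` U) setT s).
  by apply: card_le_trans KS _; apply: subset_card_le => U [/finmeet_range].
(* Passing to finite sequences preserves the size of an infinite segment only; a finite one has
   countably many sequences, and K is uncountable. *)
have [Sfin|Sinf] := pselect (finite_set S); last first.
  exact: le_init a (card_le_trans KS (range_seq_card_le _ Sinf)).
apply: Kunc; apply: card_le_trans KS _; apply: card_le_trans (card_image_le _ _) _.
have /countable_injP[f f_inj] : countable S by exact: finite_set_countable.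
have fv_inj : injective (f \o val : S -> nat).
  by move=> x y /(f_inj _ _ (valP x) (valP y))/val_inj.
apply/countable_injP; exists (fun s : seq S => pickle (map (f \o val) s)).
by move=> s t _ _ /(pcan_inj pickleK)/(inj_map fv_inj).
Qed.

(** * High points, at which no F_a contains a local pi-base *)

Section HighPoints.
Context (X : topologicalType) (x0 : X) (K : Type) (le : rel K) (B : K -> set X).
Hypothesis le_wo : wochoice.well_order le.
Hypothesis B_open : forall k, open (B k).
Hypothesis B_pi : forall V, open V -> V !=set0 -> exists2 k, B k `<=` V & B k !=set0.
Hypothesis bounded : forall g : X -> K, exists a, forall x, le (g x) a /\ g x <> a.

Definition below (a : K) : set K := [set b | le b a].

Lemma below_sub a b : le a b -> below a `<=` below b.
Proof. by move=> ab c ca; exact: wo_trans ca ab. Qed.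

Definition high (x : X) :=
  forall a, exists V, [/\ open V, V x & ~ large B (below a) V].

(** If the points that are not high were dense, a bound a for the levels of their local pi-bases
    would make the intersections of indices strictly below a a pi-base. *)
Lemma exists_open_high :
  (forall a, ~ pi_base [set U | finmeet B [set b | le b a /\ b <> a] U /\ U !=set0]) ->
  exists W, [/\ open W, W !=set0 & W `<=` high].
Proof.
move=> small; exists (~` closure (~` high)); split.
- exact/closed_openC/closed_closure.
- apply: contrapT => /nonemptyPn; rewrite -subset0 => dense.
  have /choice[g gP] x : exists a, ~ high x -> forall V, open V -> V x -> large B (below a) V.
    have [hx|/existsNP[a aP]] := pselect (high x).
      by have [k _ _] := B_pi (@openT _) (ex_intro _ x I); exists k.
    by exists a => _ V Vo Vx; apply: contrapT => nl; apply: aP; exists V.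
  have [a ga] := bounded g; apply: (small a); split.
    by move=> U [/finmeet_open Uo U0]; split=> //; exact: Uo.
  move=> V Vo [x Vx].
  have [z [zlow Vz]] : ~` high `&` V !=set0.
    have : closure (~` high) x by apply: contrapT => /dense.
    by apply; exact: open_nbhs_nbhs.
  have [U [SU U0 UV]] := gP z zlow V Vo Vz; exists U => //; split=> //.
  (* The bound a is strict, so no index up to [g z] equals a. *)
  apply: finmeet_sub SU => b bz; have [ga1 ga2] := ga z; split.
    exact: wo_trans bz ga1.
  by move=> ba; apply: ga2; apply: (wo_anti le_wo ga1); rewrite -ba.
- by move=> x nx; apply: contrapT => lx; apply: nx; exact: subset_closure.
Qed.

(* The union of the members of the j-th family that lie in O increases with j and
   is finally dense in O; as X is countable, it is constant from some j on. A
   direct supremum over U would not do: cf(K) many U may occur. *)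
Lemma large_trace O : open O -> exists j, forall a, le j a ->
  forall U, finmeet B (below a) U -> U `&` O !=set0 -> large B (below a) (U `&` O).
Proof.
move=> Oo.
pose Q x j := exists U, [/\ finmeet B (below j) U, U `<=` O & U x].
have [k0 _ _] := B_pi (@openT _) (ex_intro _ x0 I).
(* [g x] is a level at which x lies in a member contained in O; [k0] is a dummy for points that
   never do. *)
have /choice[g gP] x : exists j, (exists j, Q x j) -> Q x j.
  by have [[j]|] := pselect (exists j, Q x j); [exists j | exists k0].
have [j jP] := bounded g; exists j => a ja U aU [y [Uy Oy]].
(* A point x of [B c] lies in a member inside O at level c, hence also at level [g x], which is at
   most j. That member meets U in x. *)
have [c cUO [x cx]] : exists2 c, B c `<=` U `&` O & B c !=set0.
  by apply: B_pi; [apply: openI => //; exact: finmeet_open aU | exists y].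
have [|V [gV VO Vx]] := gP x.
  exists c, (B c); split=> //; last exact: subset_trans cUO (@subIsetr _ _ _).
  by apply: finmeet1; exact: wo_refl.
exists (U `&` V); split.
- apply: finmeet_setI aU _; apply: finmeet_sub gV; apply: below_sub.
  by have [gj _] := jP x; exact: wo_trans gj ja.
- by exists x; split=> //; have [] := cUO _ cx.
- by move=> z [Uz Vz]; split=> //; exact: VO.
Qed.

End HighPoints.

(** * Clopen sets in countable regular spaces *)

Lemma regular_closed_nbhs (X : topologicalType) (H : set X) x :
  regular_space X -> closed H -> ~ H x ->
  exists O, [/\ closed O, nbhs x O & O `&` H = set0].
Proof.
move=> Xreg Hcl Hx.
have /Xreg[Q xQ QH] : nbhs x (~` H) by apply: open_nbhs_nbhs; split=> //; exact: closed_openC.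
exists (closure Q); split; [exact: closed_closure| |].
  by apply: filterS xQ; exact: subset_closure.
by apply/seteqP; split=> // y [/QH].
Qed.

(** Glues clopen choices made piece by piece. The complement is open since it splits into the
    complement of the partitioned set and the parts of the [W k] outside [V k]. *)
Lemma clopen_partition_union (X : topologicalType) (W V : nat -> set X) :
  (forall k, clopen (W k)) -> trivIset setT W -> clopen (\bigcup_k W k) ->
  (forall k, clopen (V k)) -> clopen (\bigcup_k (V k `&` W k)).
Proof.
move=> Wc Wt UWc Vc; split.
  by apply: bigcup_open => k _; apply: openI; [exact: (Vc k).1 | exact: (Wc k).1].
rewrite -openC.
have -> : ~` (\bigcup_k (V k `&` W k)) =
    ~` (\bigcup_k W k) `|` \bigcup_k (~` V k `&` W k).
  apply/seteqP; split=> [x nx|x [nx|[k _ [nVx Wx]]] [l _ [Vx Wlx]]].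
  - have [[k _ Wx]|] := pselect ((\bigcup_k W k) x); [right|by left].
    by exists k => //; split=> // Vx; apply: nx; exists k.
  - by apply: nx; exists l.
  - have kl : k = l by apply: (Wt k l) => //; exists x.
    by apply: nVx; rewrite kl.
apply: openU; first exact: (clopenC setT UWc).1.
apply: bigcup_open => k _; apply: openI; last exact: (Wc k).1.
exact: (clopenC setT (Vc k)).1.
Qed.

Section CountableRegular.
Context (X : topologicalType) (e : nat -> X).
Hypothesis e_surj : forall x, exists n, e n = x.
Hypothesis X_regular : regular_space X.
Hypothesis closed1 : forall x : X, closed [set x].

(* Enumerate X and enlarge A or B by a closed neighbourhood of one more point at
   each stage, keeping them disjoint; in the end the two sets cover X. *)
Lemma clopen_separation (A B : set X) : closed A -> closed B -> A `&` B = set0 ->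
  exists C, [/\ clopen C, A `<=` C & C `&` B = set0].
Proof.
move=> Acl Bcl AB0.
pose good (p : set X * set X) := [/\ closed p.1, closed p.2 & p.1 `&` p.2 = set0].
pose grow (px : (set X * set X) * X) q := good px.1 ->
  [/\ good q, px.1.1 `<=` q.1, px.1.2 `<=` q.2 & nbhs px.2 q.1 \/ nbhs px.2 q.2].
have /choice[step stepP] px : exists q, grow px q.
  case: px => -[G H] x; rewrite /grow /=.
  have [[/= Gc Hc GH]|ng] := pselect (good (G, H)); last by exists (G, H).
  have [Gx|nGx] := pselect (G x).
    have nHx : ~ H x by move=> Hx; have : (G `&` H) x by []; rewrite GH.
    have [Q [Oc xO OH]] := regular_closed_nbhs X_regular Hc nHx.
    exists (G `|` Q, H) => _; split=> //=.
    - split=> //=; first exact: closedU.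
      by rewrite setIUl GH OH setU0.
    - by left; apply: filterS xO => y; right.
  have [Q [Oc xO OG]] := regular_closed_nbhs X_regular Gc nGx.
  exists (G, H `|` Q) => _; split=> //=.
  - split=> //=; first exact: closedU.
    by rewrite setIUr GH setIC OG setU0.
  - by right; apply: filterS xO => y; right.
pose F := nat_rect _ (A, B) (fun n p => step (p, e n)).
have Fgood n : good (F n).
  by elim: n => [|n IH]; [split | have [] := stepP (F n, e n) IH].
have F1 n m : (n <= m)%N -> (F n).1 `<=` (F m).1 /\ (F n).2 `<=` (F m).2.
  elim: m => [|m IH]; first by rewrite leqn0 => /eqP->; split.
  rewrite leq_eqVlt ltnS => /predU1P[->|/IH[F1 F2]]; first by split.
  have [_ S1 S2 _] := stepP (F m, e m) (Fgood m).
  by split; [exact: subset_trans F1 S1 | exact: subset_trans F2 S2].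
pose C := \bigcup_n (F n).1; pose D := \bigcup_n (F n).2.
have CD x : C x -> D x -> False.
  move=> [n _ nx] [m _ mx]; have [_ _] := Fgood (maxn n m); rewrite -subset0; apply.
  by split; [apply: (F1 _ _ (leq_maxl n m)).1 nx | apply: (F1 _ _ (leq_maxr n m)).2 mx].
(* As C and D are disjoint, this makes them open and complementary. *)
have CDn (x : X) : nbhs x C \/ nbhs x D.
  have [n <-] := e_surj x; have [_ _ _ [h|h]] := stepP (F n, e n) (Fgood n); [left|right];
    by apply: filterS h => y ?; exists n.+1.
exists C; split.
- split.
    rewrite openE => x Cx; case: (CDn x) => // /nbhs_singleton Dx; exfalso; exact: CD Cx Dx.
  rewrite -openC openE => x nCx; case: (CDn x) => [/nbhs_singleton//|].
  by apply: filterS => y Dy Cy; exact: CD Cy Dy.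
- by move=> x Ax; exists 0.
- by apply/seteqP; split=> // x [Cx Bx]; apply: CD Cx _; exists 0.
Qed.

Lemma clopen_nbhs x (V : set X) : open V -> V x ->
  exists C, [/\ clopen C, C x & C `<=` V].
Proof.
move=> Vo Vx; have [|||C [Cc Cx CV]] := @clopen_separation [set x] (~` V).
- exact: closed1.
- exact: open_closedC.
- by apply/seteqP; split=> // y [-> /(_ Vx)].
exists C; split=> //; first exact: Cx.
by move=> y Cy; apply: contrapT => nVy; have : (C `&` ~` V) y by []; rewrite CV.
Qed.

Lemma clopen_bigcup_finite (F : nat -> set X) n :
  (forall k, clopen (F k)) -> clopen (\bigcup_(k < n) F k).
Proof.
move=> Fc; split; first by apply: bigcup_open => k _; exact: (Fc k).1.
by apply: closed_bigcup => // k _; exact: (Fc k).2.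
Qed.

Lemma seqDU_clopen (F : nat -> set X) k :
  (forall k, clopen (F k)) -> clopen (seqDU F k).
Proof.
move=> Fc; rewrite /seqDU setDE; apply: clopenI; first exact: Fc.
by apply: (clopenC setT); rewrite -bigcup_mkord; exact: clopen_bigcup_finite.
Qed.

(** Each D without x is closed, so x has a clopen neighbourhood that meets D at most in x. These
    neighbourhoods are made disjoint along the enumeration [e]. *)
Lemma closed_discrete_partition (Y D : set X) : clopen Y -> closed_discrete D ->
  exists W : nat -> set X, [/\ forall k, clopen (W k), trivIset setT W,
    \bigcup_k W k = Y & forall k, W k `&` D `<=` [set e k]].
Proof.
move=> Yc [Dcl Diso].
have DD x : closed (D `\ x).
  rewrite -openC openE => y ny.
  have [Dy|nDy] := pselect (D y); last first.
    by apply: filterS (open_nbhs_nbhs (conj (closed_openC Dcl) nDy)) => z nDz [].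
  have -> : x = y by apply: contrapT => xy; apply: ny; split=> // /esym.
  move: Dy; rewrite -{1}Diso => -[_ [V yV VD]]; apply: filterS yV => z Vz [Dz zy].
  by apply: zy; rewrite -VD.
have /choice[N NP] x : exists C, [/\ clopen C, C x & C `&` D `<=` [set x]].
  have [||C [Cc Cx CD]] := @clopen_nbhs x (~` (D `\ x)).
  - exact: closed_openC.
  - by move=> [_]; apply.
  - exists C; split=> // y [Cy Dy]; apply: contrapT => yx.
    by apply: (CD _ Cy); split.
pose M k := N (e k) `&` Y.
have Mc k : clopen (M k) by apply: clopenI => //; have [] := NP (e k).
exists (seqDU M); split.
- by move=> k; exact: seqDU_clopen.
- exact: trivIset_seqDU.
- rewrite -seqDU_bigcup_eq; apply/seteqP; split=> [y [k _ []//]|y Yy].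
  by have [k ky] := e_surj y; exists k => //; split=> //; rewrite ky; have [] := NP y.
- move=> k y [Wy Dy]; have [Ny _] : M k y by exact: subset_seqDU Wy.
  by have [_ _] := NP (e k); apply.
Qed.

(** The pieces are the successive differences of a strictly decreasing sequence of clopen sets that
    starts at Y and drops the point [e n] by stage n + 1, so that its intersection is empty. *)
Lemma infinite_clopen_partition (Y : set X) : clopen Y -> Y !=set0 ->
  isolated [set: X] = set0 ->
  exists Z : nat -> set X, [/\ forall k, clopen (Z k), trivIset setT Z,
    \bigcup_k Z k = Y & forall k, Z k !=set0].
Proof.
move=> Yc Y0 noiso.
pose shrink (Cx : set X * X) C' := clopen Cx.1 -> Cx.1 !=set0 ->
  [/\ clopen C', C' !=set0, C' `<=` Cx.1, ~ C' Cx.2 & (Cx.1 `\` C') !=set0].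
have /choice[step stepP] Cx : exists C', shrink Cx C'.
  case: Cx => C x; rewrite /shrink /=.
  have [[Cc [z Cz]]|nC] := pselect (clopen C /\ C !=set0); last by exists C => c0 c1; case: nC.
  have other (V : set X) y : open V -> V y -> exists2 t, V t & t <> y.
    move=> Vo Vy; apply: contrapT => nt; have : isolated [set: X] y.
      split; first by rewrite inE.
      exists V; first exact: open_nbhs_nbhs.
      rewrite setIT; apply/seteqP; split=> [t Vt|_ ->//].
      by apply: contrapT => ty; apply: nt; exists t.
    by rewrite noiso.
  have [t Ct tz] := other C z Cc.1 Cz.
  (* The next set is built around w; removing z as well keeps the difference non-empty when x is not
     in C. *)
  have [w [Cw wx wz]] : exists w, [/\ C w, w <> x & w <> z].
    have [tx|tx] := pselect (t = x); last by exists t.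
    have [||w [Cw wz] wx] := other (C `\ z) x.
    - by rewrite setDE; apply: openI; [exact: Cc.1 | exact: closed_openC].
    - by rewrite -tx.
    - by exists w.
  have [||C' [C'c C'w C'sub]] := @clopen_nbhs w (C `\` [set x; z]).
  - by rewrite setDE; apply: openI; [exact: Cc.1 | apply: closed_openC; exact: closedU].
  - by split=> // -[].
  - exists C' => _ _; split=> //; [by exists w|by move=> y /C'sub[]| |].
      by move=> /C'sub[_]; apply; left.
    by exists z; split=> // /C'sub[_]; apply; right.
pose C := nat_rect (fun _ => set X) Y (fun n D => step (D, e n)).
have CP n : clopen (C n) /\ C n !=set0.
  by elim: n => [|n [IH1 IH2]]//; have [] := stepP (C n, e n) IH1 IH2.
have CS n := stepP (C n, e n) (CP n).1 (CP n).2.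
have Cmono n m : (n <= m)%N -> C m `<=` C n.
  elim: m => [|m IH]; first by rewrite leqn0 => /eqP->.
  rewrite leq_eqVlt ltnS => /predU1P[->//|/IH]; apply: subset_trans.
  by have [] := CS m.
exists (fun n => C n `\` C n.+1); split.
- by move=> n; rewrite setDE; apply: clopenI; [exact: (CP n).1 | exact: (clopenC setT (CP n.+1).1)].
- move=> n m _ _ [x [[nx nx'] [mx mx']]].
  case: (ltngtP n m) => // nm; exfalso; [apply: nx'|apply: mx']; exact: Cmono nm _ _.
- apply/seteqP; split=> [x [n _ [nx _]]|x Yx]; first exact: Cmono (leq0n n) _ nx.
  have [n nx] := e_surj x.
  have xn : ~ C n.+1 x by rewrite -nx; have [] := CS n.
  (* Descend to the first stage that has lost x; stage 0 is Y, which contains x. *)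
  elim: {nx} n xn => [|n IH] xn.
    by exists 0.
  by have [/= nx|/IH//] := pselect (C n.+1 x); exists n.+1.
- by move=> n; have [] := CS n.
Qed.

End CountableRegular.

(** * Linked clopen neighbourhoods of closed discrete sets *)

Section Linked.
Context (X : topologicalType) (e : nat -> X) (K : Type) (le : rel K) (B : K -> set X).
Hypothesis e_surj : forall x, exists n, e n = x.
Hypothesis X_regular : regular_space X.
Hypothesis closed1 : forall x : X, closed [set x].
Hypothesis le_wo : wochoice.well_order le.
Hypothesis B_open : forall k, open (B k).
Hypothesis B_pi : forall V, open V -> V !=set0 -> exists2 k, B k `<=` V & B k !=set0.
Hypothesis bounded : forall g : X -> K, exists a, forall x, le (g x) a /\ g x <> a.

Let below := below le.
Let high := high le B.

Lemma wo_upper a b : exists c, le a c /\ le b c.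
Proof.
have [ab|ba] := wo_total le_wo a b; [exists b|exists a];
  by split=> //; exact: wo_refl.
Qed.

(** Cut Y into pieces [W k] with at most the point [e k] of D in each, and use that [e k] is high. A
    trace of P on [W k] need not belong to any family, but [large_trace] finds a member inside it at
    a level b, which may depend on k. *)
Lemma avoiding_clopen (Y D : set X) a :
  clopen Y -> Y `<=` high -> closed_discrete D ->
  exists U, [/\ clopen U, D `&` Y `<=` U &
    forall P, finmeet B (below a) P -> P !=set0 -> P `<=` Y -> ~ (P `<=` U)].
Proof.
move=> Yc Yhigh Dcd.
have [W [Wc Wt WY WD]] := closed_discrete_partition e_surj X_regular closed1 Yc Dcd.
have /choice[V VP] k : exists V, [/\ clopen V, Y (e k) -> V (e k) &
    forall P, finmeet B (below a) P -> P `&` W k !=set0 -> ~ (P `&` W k `<=` V)].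
  have [j jP] := large_trace (e 0) le_wo B_open B_pi bounded (Wc k).1.
  have [b [ab jb]] := wo_upper a j.
  have {}jP P : finmeet B (below a) P -> P `&` W k !=set0 -> large B (below b) (P `&` W k).
    by move=> aP; apply: jP jb _ _; apply: finmeet_sub aP; exact: below_sub.
  have [Yk|nYk] := pselect (Y (e k)); last first.
    exists set0; split=> //; first exact: clopen0.
    by move=> P _ [x Px] /(_ x Px).
  have [V [Vo Vk Vb]] := Yhigh _ Yk b.
  have [C [Cc Ck CV]] := clopen_nbhs e_surj X_regular closed1 Vo Vk.
  exists C; split=> // P aP PW PC; apply: Vb; apply: large_sub (jP _ aP PW) => //.
  exact: subset_trans PC CV.
exists (\bigcup_k (V k `&` W k)); split.
- by apply: clopen_partition_union => //; [rewrite WY | move=> k; have [] := VP k].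
- move=> x [Dx Yx]; have : (\bigcup_k W k) x by rewrite WY.
  move=> [k _ Wx]; exists k => //; split=> //.
  have xk : x = e k by apply: WD.
  by have [_ + _] := VP k; rewrite -xk; apply.
- move=> P aP [x Px] PY PU; have : (\bigcup_k W k) x by rewrite WY; exact: PY.
  move=> [k _ Wx]; have [_ _] := VP k; apply; [exact: aP | by exists x|].
  move=> y [/PU[l _ [Vly Wly]] Wky].
  by have -> : k = l by apply: (Wt k l) => //; exists y.
Qed.

(** [tower_step] returns a member of the next family, so that the shrinking can go on, possibly with
    the sets of another tower. *)
Record tower (Y : set X) (a : K) (U : nat -> set X) (r : nat -> K) : Prop := {
  tower_clopen : forall k, clopen (U k);
  tower_start : r 0 = a;
  tower_mono : forall k, U k.+1 `<=` U k;
  tower_step : forall k P, finmeet B (below (r k)) P -> P !=set0 -> P `<=` Y ->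
    large B (below (r k.+1)) (P `\` U k.+1) }.

(** Iterate [avoiding_clopen]: P is not contained in the new set, so it has a non-empty trace on the
    open complement, and [large_trace] gives a member in that trace. *)
Lemma exists_tower (Y D : set X) a :
  clopen Y -> Y `<=` high -> closed_discrete D ->
  exists U r, tower Y a U r /\ forall k, D `&` Y `<=` U k.
Proof.
move=> Yc Yhigh Dcd.
pose good (Ur : set X * K) := clopen Ur.1 /\ D `&` Y `<=` Ur.1.
pose next (Ur Ur' : set X * K) := good Ur -> [/\ good Ur', Ur'.1 `<=` Ur.1 &
  forall P, finmeet B (below Ur.2) P -> P !=set0 -> P `<=` Y ->
    large B (below Ur'.2) (P `\` Ur'.1)].
have /choice[step stepP] Ur : exists Ur', next Ur Ur'.
  case: Ur => U r; rewrite /next /=.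
  have [[/= Uc UD]|ng] := pselect (good (U, r)); last by exists (U, r).
  have [U' [U'c U'D U'P]] := avoiding_clopen r Yc Yhigh Dcd.
  have UU'c : clopen (U `&` U') by exact: clopenI.
  (* The next level must lie above r and above the level j from which traces on the complement are
     large. *)
  have [j jP] := large_trace (e 0) le_wo B_open B_pi bounded (clopenC setT UU'c).1.
  have [b [rb jb]] := wo_upper r j.
  exists (U `&` U', b) => _; split=> [|x []//|P rP P0 PY] /=.
    by split=> //= x DYx; split; [exact: UD | exact: U'D].
  rewrite setDE; apply: jP jb _ _ _; first by apply: finmeet_sub rP; exact: below_sub.
  apply: contrapT => nP; apply: (U'P P rP P0 PY) => x Px.
  by apply: contrapT => nU'x; apply: nP; exists x; split=> // -[].
pose F := nat_rect (fun _ => (set X * K)%type) (setT, a) (fun _ => step).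
have Fgood n : good (F n).
  elim: n => [|n IH]; first by split=> //; exact: clopenT.
  by have [] := stepP (F n) IH.
exists (fun n => (F n).1), (fun n => (F n).2); split; last by move=> k; case: (Fgood k).
split=> //.
- by move=> k; case: (Fgood k).
- by move=> k; have [] := stepP (F k) (Fgood k).
- by move=> k; have [] := stepP (F k) (Fgood k).
Qed.

Lemma tower_anti Y a U r k l : tower Y a U r -> (k <= l)%N -> U l `<=` U k.
Proof.
move=> T; elim: l => [|l IH]; first by rewrite leqn0 => /eqP->.
rewrite leq_eqVlt ltnS => /predU1P[->//|/IH]; apply: subset_trans.
exact: tower_mono T l.
Qed.

(* Van Douwen's argument: at each step use the member of L whose next rank is least. *)
Lemma tower_linked (I : eqType) (Y : set X) a (U : I -> nat -> set X) (r : I -> nat -> K) :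
  (forall i, tower Y a (U i) (r i)) ->
  forall N (L : seq I) k c P, (k + size L <= N)%N ->
  (forall i, i \in L -> le c (r i k)) ->
  finmeet B (below c) P -> P !=set0 -> P `<=` Y ->
  exists2 x, P x & forall i, i \in L -> ~ U i N x.
Proof.
move=> T N L; move: {2}(size L) (erefl (size L)) => n.
elim: n L => [|n IH] L Ln k c P kN cr cP P0 PY.
  by case: P0 => x Px; exists x => // i; move/size0nil: Ln => ->.
have [_ [i iL <-] imin] : exists2 z, [set r i k.+1 | i in [set` L]] z &
    forall z', [set r i k.+1 | i in [set` L]] z' -> le z z'.
  apply: (wo_min le_wo); case: L Ln {IH kN cr} => // i L _.
  by exists (r i k.+1), i => //=; rewrite inE eqxx.
have perm := perm_to_rem iL.
have iP : finmeet B (below (r i k)) P by apply: finmeet_sub cP; apply: below_sub => //; exact: cr.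
have [Q [rQ Q0 QP]] := tower_step (T i) iP P0 PY.
(* Q avoids [U i k.+1]. By the minimal choice of i its level is at most the next level of every
   remaining tower. *)
have [||||||x Qx xL] := IH (rem i L) _ k.+1 (r i k.+1) Q.
- by rewrite size_rem// Ln.
- by rewrite size_rem// Ln /= addSnnS -Ln.
- by move=> j /mem_rem jL; apply: imin; exists j.
- exact: rQ.
- exact: Q0.
- by move=> y /QP[/PY].
exists x => [|j]; first by have [] := QP _ Qx.
rewrite (perm_mem perm) inE => /predU1P[->|/xL//] UN.
(* As L is non-empty, k < N, so [U i N] lies in [U i k.+1]. *)
have [_] := QP _ Qx; apply; apply: tower_anti (T i) _ _ UN.
by apply: leq_trans kN; rewrite Ln addnS ltnS leq_addr.
Qed.

Lemma clopen_filter_base W : open W -> W !=set0 -> W `<=` high ->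
  isolated [set: X] = set0 ->
  exists A : set X -> set X, [/\ forall D, clopen (A D),
    forall D, closed_discrete D -> A D `&` D = set0 &
    forall L : seq (set X), exists x, forall D, D \in L -> A D x].
Proof.
move=> Wo [w Ww] Whigh noiso.
have [Y [Yc Yw YW]] := clopen_nbhs e_surj X_regular closed1 Wo Ww.
have [Z [Zc Zt ZY Z0]] :=
  infinite_clopen_partition e_surj X_regular closed1 Yc (ex_intro _ w Yw) noiso.
have Zhigh n : Z n `<=` high.
  by move=> x Zx; apply/Whigh/YW; rewrite -ZY; exists n.
(* All towers on [Z n] will start at the level [k n], where [B (k n)] is a member inside [Z n] with
   which the shrinking can begin. *)
have /choice[k kP] n : exists k, B k `<=` Z n /\ B k !=set0.
  by have [k ? ?] := B_pi (Zc n).1 (Z0 n); exists k.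
(* A set D that is not closed discrete gets a tower of the empty set, so that [A D] is still clopen
   and linked with the others. *)
have cd0 : closed_discrete (set0 : set X).
  split; first exact: closed0.
  by apply/seteqP; split=> // x [/set_mem].
pose R (nD : nat * set X) (Ur : (nat -> set X) * (nat -> K)) :=
  tower (Z nD.1) (k nD.1) Ur.1 Ur.2 /\
  (closed_discrete nD.2 -> forall m, nD.2 `&` Z nD.1 `<=` Ur.1 m).
have /choice[f fP] nD : exists Ur, R nD Ur.
  case: nD => n D; rewrite /R /=.
  have [Dcd|nDcd] := pselect (closed_discrete D).
    by have [U [r [T UD]]] := exists_tower (k n) (Zc n) (@Zhigh n) Dcd; exists (U, r).
  by have [U [r [T _]]] := exists_tower (k n) (Zc n) (@Zhigh n) cd0; exists (U, r).
exists (fun D => \bigcup_n (~` ((f (n, D)).1 n) `&` Z n)); split.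
- move=> D; apply: clopen_partition_union => //; first by rewrite ZY.
  by move=> n; apply: (clopenC setT); have [T _] := fP (n, D); exact: tower_clopen T n.
- move=> D Dcd; apply/seteqP; split=> // x [[n _ [nUx Zx]] Dx]; apply: nUx.
  by have [_ /(_ Dcd n)] := fP (n, D); apply.
(* A list of n sets is handled in [Z n], where every tower is cut at stage n. *)
- move=> L; pose n := size L; have [kn kn0] := kP n.
  have [||||x kx xL] := @tower_linked _ (Z n) (k n) (fun D => (f (n, D)).1)
    (fun D => (f (n, D)).2) _ n L 0 (k n) (B (k n)) _ _ _ kn0 kn.
  - by move=> D; have [] := fP (n, D).
  - exact: leqnn.
  - by move=> D _; have [/tower_start -> _] := fP (n, D); exact: wo_refl.
  - by apply: finmeet1; exact: wo_refl.
  - exists x => D DL; exists n => //; split; first exact: xL.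
    exact: kn.
Qed.

End Linked.

(** * From a clopen filter base to a far point *)

Local Open Scope ring_scope.

Lemma compact_unit_cube (R : realType) (I : Type) :
  compact [set q : prod_topology (fun _ : I => R : topologicalType) | forall i, 0 <= q i <= 1].
Proof.
elim/Peq: I => I.
have := @tychonoff I (fun _ => R) (fun _ => `[0, 1]%classic) (fun _ => @segment_compact R 0 1).
by congr compact; apply/seteqP; split=> q /= qP i; have := qP i; rewrite /= in_itv.
Qed.

Lemma coord_continuous (I : Type) (K : I -> topologicalType) i :
  continuous (fun q : prod_topology K => q i).
Proof. by elim/Peq: I => I in K i *; exact: proj_continuous. Qed.

Lemma clopen_indic_continuous (R : realType) (X : topologicalType) (A : set X) :
  clopen A -> continuous (\1_A : X -> R).
Proof.
move=> [Ao Ac] x; have [Ax|nAx] := pselect (A x).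
  apply: cvg_near_cst; apply: filterS (open_nbhs_nbhs (conj Ao Ax)) => y Ay.
  by rewrite !indicE !mem_set.
apply: cvg_near_cst; apply: filterS (open_nbhs_nbhs (conj (closed_openC Ac) nAx)) => y Ay.
by rewrite !indicE !memNset.
Qed.

Lemma indic_unit (R : realType) (X : Type) (A : set X) x : 0 <= (\1_A x : R) <= 1.
Proof. by rewrite indicE; case: (x \in A); rewrite ?lexx ?ler01. Qed.

Section FarPoint.
Context (R : realType) (X : topologicalType).
Notation ev := (@evaluation R X).
Notation cube := (prod_topology (fun _ : unit_fun R X => R)).

Definition clopen_unit_fun (A : set X) (Ac : clopen A) : unit_fun R X :=
  exist _ (\1_A) (conj (@clopen_indic_continuous R X A Ac)
    (@indic_unit R X A)).

Lemma coord_open (f : unit_fun R X) (c : R) : open [set q : cube | q f != c].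
Proof.
have /continuousP : continuous (fun q : cube => q f) by exact: coord_continuous.
by move=> /(_ _ (@open_neq R c)).
Qed.

(** The indicator of [A D] takes the value 1 at any cluster point of the filter and vanishes on D,
    which separates the cluster point from D. *)
Lemma clopen_filter_far_point (A : set X -> set X) :
  hausdorff_space X ->
  (forall D, clopen (A D)) -> (forall D, closed_discrete D -> A D `&` D = set0) ->
  (forall L : seq (set X), exists x, forall D, D \in L -> A D x) ->
  exists p : stone_cech R X, far_point p.
Proof.
move=> X_hausdorff Ac AD Afip.
pose F : set_system X := [set S | exists L : seq (set X),
  forall x, (forall D, D \in L -> A D x) -> S x].
have FA D : F (A D) by exists [:: D] => x; apply; rewrite inE.
have FF : ProperFilter F.
  split.
    by move=> [L LP]; have [x /LP] := Afip L.
  split; first by exists [::].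
    move=> S S' [L LP] [L' LP']; exists (L ++ L') => x LL'; split.
      by apply: LP => D DL; apply: LL'; rewrite mem_cat DL.
    by apply: LP' => D DL; apply: LL'; rewrite mem_cat DL orbT.
  by move=> S S' SS' [L LP]; exists L => x /LP/SS'.
(* Compactness of the cube gives a cluster point of the image filter. *)
have [|p [p01 pcl]] := @compact_unit_cube R (unit_fun R X) (ev @ F) _.
  by exists [::] => x _ f; exact: (svalP f).2.
have p_closure : closure (range ev) p.
  move=> V pV; have [|q [Fq Vq]] := pcl (range ev) V _ pV; last by exists q.
  by exists [::] => x _; exists x.
pose one D := clopen_unit_fun (Ac D).
have p_one D : p (one D) = 1.
  apply: contrapT => p1.
  have [| |q [[x Ax <-]]] := pcl (ev @` A D) [set q | q (one D) != 1].
  - by exists [:: D] => x Ax; exists x => //; apply: Ax; rewrite inE.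
  - apply: open_nbhs_nbhs; split; last exact/eqP.
    exact: coord_open.
  - by rewrite /= /evaluation /= indicE mem_set// eqxx.
exists (SigSub (mem_set p_closure)).
have far D : closed_discrete D -> ~ closure (@to_stone_cech R X @` D) (SigSub (mem_set p_closure)).
  move=> Dcd Dp.
  have [|q [[x Dx <-]]] := Dp [set q : stone_cech R X | val q (one D) != 0].
    apply: open_nbhs_nbhs; split; last by rewrite /= p_one oner_neq0.
    have /continuousP := @initial_continuous _ _ (@set_val _ (closure (range ev))).
    by move=> /(_ _ (coord_open (one D) (0 : R))).
  rewrite /= /evaluation /= indicE memNset ?eqxx// => Ax.
  by have : (A D `&` D) x by []; rewrite AD.
(* Singletons are closed discrete, so p is not the image of a point of X. *)
split=> // -[x _ xp]; apply: (far [set x]).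
  split; first exact/accessible_closed_set1/hausdorff_accessible.
  apply/seteqP; split=> [y [/set_mem//]|_ ->].
  split; first exact: mem_set.
  by exists setT; [exact: filterT | rewrite setTI].
by rewrite -xp; apply: subset_closure; exists x.
Qed.

End FarPoint.

Local Close Scope ring_scope.

Theorem corollary4p6 (R : realType) (X : topologicalType) (K : Type)
  (X_countable : countable [set: X])
  (X_hausdorff : hausdorff_space X) (X_regular : regular_space X)
  (X_crowded : crowded X)
  (K_pi_weight : is_pi_weight X K)
  (K_cofinality : uncountable_cofinality K) :
  exists p : stone_cech R X, far_point p.
Proof.
have [[x0 _] noiso] := X_crowded.
have [le le_init K_cof] := K_cofinality; have [le_wo _] := le_init.
have closed1 (x : X) : closed [set x].
  exact/accessible_closed_set1/hausdorff_accessible.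
have [e e_surj] : exists e : nat -> X, forall x, exists n, e n = x.
  case/pfcard_geP: X_countable => [X0|/surjfunPex[e eE]].
    by have : [set: X] x0 by []; rewrite X0.
  by exists e => x; have : [set: X] x by []; rewrite eE => -[n _ <-]; exists n.
have [B [B_open B_pi]] : exists B : K -> set X, (forall k, open (B k)) /\
    forall V, open V -> V !=set0 -> exists2 k, B k `<=` V & B k !=set0.
  have [[P [P_open P_pi] PK] _] := K_pi_weight.
  move: PK; rewrite card_eq_le => /andP[/pfcard_geP[P0|/surjfunPex[B BE]] _].
    by have [U] := P_pi _ openT (ex_intro _ x0 I); rewrite P0.
  exists B; split=> [k|V Vo V0]; first by apply: (P_open _ _).1; rewrite BE; exists k.
  have [U PU UV] := P_pi V Vo V0; move: (PU); rewrite BE => -[k _ kU].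
  by exists k; rewrite kU //; exact: (P_open _ PU).2.
(* K is cofinal in itself. *)
have K_uncountable : ~ countable [set: K].
  by apply: K_cof => a; exists a => //; exact: wo_refl.
have bounded (g : X -> K) : exists a, forall x, le (g x) a /\ g x <> a.
  (* The range of g is countable, hence not cofinal; an element a with no value of g above it is a
     strict upper bound. *)
  have /existsNP[a aP] : ~ cofinal le (range g).
    move=> /K_cof; apply; apply: card_le_trans X_countable; exact: card_image_le.
  exists a => x; have nag : ~ le a (g x) by move=> ag; apply: aP; exists (g x) => //; exists x.
  split; first by case: (wo_total le_wo a (g x)).
  by move=> gxa; apply: nag; rewrite gxa; exact: wo_refl.
have [W [Wo W0 Whigh]] := exists_open_high le_wo B_open B_pi bounded
  (fun a => finmeet_not_pi_base (B := B) (a := a) K_pi_weight le_init K_uncountable).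
have [A [Ac AD Afip]] := clopen_filter_base e_surj X_regular closed1 le_wo B_open B_pi
  bounded Wo W0 Whigh noiso.
exact: clopen_filter_far_point X_hausdorff Ac AD Afip.
Qed.
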